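(* Let $\mathcal{X}$ be a real Banach space, $\mathcal{C}\subset\mathcal{X}$ a closed pointed convex normal cone with nonempty interior $\mathcal{C}^0$, $\mathbf{e}\in\mathcal{C}^0$, and let $T:\mathcal{X}\to\mathcal{X}$ be a consensus operator with respect to $\mathbf{e}$, i.e. a linear map with $T(\mathcal{C})\subset\mathcal{C}$ and $T(\mathbf{e})=\mathbf{e}$. If $\|T\|_H<1$, or equivalently $\|T^\star\|_H^\star<1$, then there is $\pi\in\mathcal{P}(\mathbf{e})$ such that, for all $n\in\mathbb{N}$ and all $x\in\mathcal{X}$, $$\|T^n(x)-\langle\pi,x\rangle\mathbf{e}\|_T\le(\|T\|_H)^n\,\|x\|_H,$$ and, for all $n\in\mathbb{N}$ and all $\mu\in\mathcal{P}(\mathbf{e})$, $$\|(T^\star)^n(\mu)-\pi\|_H^\star\le(\|T\|_H)^n.$$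
   Context: Pointed convex cone: $\alpha\mathcal{C}\subset\mathcal{C}$ for $\alpha\ge0$, $\mathcal{C}+\mathcal{C}\subset\mathcal{C}$, $\mathcal{C}\cap(-\mathcal{C})=\{0\}$. Order: $x\le y$ iff $y-x\in\mathcal{C}$. Normal: there is $K>0$ with $0\le x\le y\Rightarrow\|x\|\le K\|y\|$. Thompson's norm: $\|x\|_T=\inf\{\alpha>0:-\alpha\mathbf{e}\le x\le\alpha\mathbf{e}\}$, with dual norm $\|\cdot\|_T^\star$ on $\mathcal{X}^\star$. Hopf's oscillation seminorm: $\|x\|_H=\inf\{t\in\mathbb{R}:x\le t\mathbf{e}\}-\sup\{t\in\mathbb{R}:x\ge t\mathbf{e}\}$. Dual cone $\mathcal{C}^\star=\{\mu\in\mathcal{X}^\star:\langle\mu,x\rangle\ge0\ \forall x\in\mathcal{C}\}$; $\mathcal{P}(\mathbf{e})=\{\mu\in\mathcal{C}^\star:\langle\mu,\mathbf{e}\rangle=1\}$; $\mathcal{M}(\mathbf{e})=\{\mu\in\mathcal{X}^\star:\langle\mu,\mathbf{e}\rangle=0\}$, with norm $\|\mu\|_H^\star=\frac12\|\mu\|_T^\star$. $\|T\|_H=\sup\{\|T(x)\|_H:x\in\mathcal{X},\ \|x\|_H\le1\}$. $T^\star$ is the adjoint of $T$ (it maps $\mathcal{M}(\mathbf{e})$ to itself), and $\|T^\star\|_H^\star=\sup\{\|T^\star(\mu)\|_H^\star:\mu\in\mathcal{M}(\mathbf{e}),\ \|\mu\|_H^\star\le1\}$. *)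

(* Defs.v *)
From HB Require Import structures.
From mathcomp Require Import all_boot all_order all_algebra.
From mathcomp Require Import all_classical all_reals all_analysis.

Set Implicit Arguments.
Unset Strict Implicit.
Unset Printing Implicit Defensive.

Import Order.TTheory GRing.Theory Num.Theory.
Import numFieldNormedType.Exports.

Local Open Scope classical_set_scope.
Local Open Scope ring_scope.

Definition pointed_convex_cone (R : realType) (X : normedModType R)
    (C : set X) : Prop :=
  [/\ forall (a : R) (x : X), 0 <= a -> C x -> C (a *: x),
      forall x y : X, C x -> C y -> C (x + y) &
      C `&` (-%R @` C) = [set 0]].

Definition cone_le (R : realType) (X : normedModType R) (C : set X)
    (x y : X) : Prop :=
  C (y - x).

Definition normal_cone (R : realType) (X : normedModType R)
    (C : set X) : Prop :=
  exists2 K : R, 0 < K &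
    forall x y : X, cone_le C 0 x -> cone_le C x y -> `|x| <= K * `|y|.

(* The infima and suprema below are those of real sets, which library
   convention sends to 0 on an empty or unbounded set. When C is a closed
   pointed convex normal cone, e is a nonzero interior point of C, T is a
   consensus operator and mu is continuous, all of these sets are nonempty and
   bounded on the relevant side, so no such default value occurs. *)

Definition thompson_norm (R : realType) (X : normedModType R) (C : set X)
    (e x : X) : R :=
  inf [set a : R | [/\ 0 < a, cone_le C (- (a *: e)) x
                            & cone_le C x (a *: e)]].

Definition hopf_seminorm (R : realType) (X : normedModType R) (C : set X)
    (e x : X) : R :=
  inf [set t : R | cone_le C x (t *: e)]
  - sup [set t : R | cone_le C (t *: e) x].

Definition dual_space (R : realType) (X : normedModType R) :
    set (X -> R^o) :=
  [set mu | linear mu /\ continuous mu].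
Arguments dual_space {R} X _.

Definition dual_cone (R : realType) (X : normedModType R) (C : set X) :
    set (X -> R^o) :=
  [set mu | dual_space X mu /\ forall x : X, C x -> 0 <= mu x].

(* $\mathcal{P}(\mathbf{e})$ *)
Definition unit_functionals (R : realType) (X : normedModType R) (C : set X)
    (e : X) : set (X -> R^o) :=
  [set mu | dual_cone C mu /\ mu e = 1].

(* $\mathcal{M}(\mathbf{e})$ *)
Definition null_functionals (R : realType) (X : normedModType R) (e : X) :
    set (X -> R^o) :=
  [set mu | dual_space X mu /\ mu e = 0].

Definition dual_thompson_norm (R : realType) (X : normedModType R)
    (C : set X) (e : X) (mu : X -> R^o) : R :=
  sup [set `|mu x| | x in [set x : X | thompson_norm C e x <= 1]].

Definition dual_hopf_norm (R : realType) (X : normedModType R)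
    (C : set X) (e : X) (mu : X -> R^o) : R :=
  2^-1 * dual_thompson_norm C e mu.

Definition consensus_operator (R : realType) (X : normedModType R)
    (C : set X) (e : X) (T : X -> X) : Prop :=
  [/\ linear T, T @` C `<=` C & T e = e].

Definition adjoint (R : realType) (X : normedModType R) (T : X -> X)
    (mu : X -> R^o) : X -> R^o :=
  mu \o T.

Definition hopf_opnorm (R : realType) (X : normedModType R) (C : set X)
    (e : X) (T : X -> X) : R :=
  sup [set hopf_seminorm C e (T x) | x in
        [set x : X | hopf_seminorm C e x <= 1]].

(* The argument S acts on functionals; it is used with S = adjoint T. *)
Definition dual_hopf_opnorm (R : realType) (X : normedModType R) (C : set X)
    (e : X) (S : (X -> R^o) -> (X -> R^o)) : R :=
  sup [set dual_hopf_norm C e (S mu) | mu in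
        [set mu | null_functionals e mu /\ dual_hopf_norm C e mu <= 1]].

(* Main.v *)
Require Import Defs.
From HB Require Import structures.
From mathcomp Require Import all_boot all_order all_algebra.
From mathcomp Require Import all_classical all_reals all_analysis.
From mathcomp Require Import lra.
Import Order.TTheory GRing.Theory Num.Theory.
Import numFieldNormedType.Exports.
Local Open Scope classical_set_scope.
Local Open Scope ring_scope.

(** Everything is expressed through one function, the gauge
    [top x] = inf {t | x <= t e}. Since [e] is interior to the closed pointed
    cone [C], the infimum is attained, so that x <= t e iff [top x <= t]
    ([topP]), and [top] is sublinear. The largest t with t e <= x is
    - [top (- x)], whence
      ||x||_H = top x + top (- x)   and   ||x||_T = max (top x) (top (- x)),
    and the elements of P(e) are exactly the linear functionals dominated by
    [top] ([unit_functionalP]). A consensus operator does not increase [top].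

    The limit. Put h = ||T||_H < 1. Along the orbit of x the values
    [top (T^n x)] decrease, and they stay above the values - [top (- T^n x)],
    which increase; the gap between them is ||T^n x||_H <= h^n ||x||_H. Hence
    pi x = inf_n [top (T^n x)] is a sublinear functional with
    pi x + pi (- x) <= 0, which forces it to be linear ([consensus_limit]). Since
    pi x lies between - [top (- T^n x)] and [top (T^n x)], two numbers at
    distance ||T^n x||_H, the first estimate follows. The second one follows by
    duality: a functional mu in P(e) satisfies |mu y| <= ||y||_T and
    mu (T^n x) - pi x = mu (T^n x - pi x e), while ||x||_H <= 2 ||x||_T compensates the factor 1/2 in the dual norm.

    The equivalence. In fact ||T||_H = ||T^*||_H^* ([hopf_opnorm_adjoint]).
    A functional mu that kills e satisfies |mu x| <= ||mu||_H^* ||x||_H, because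
    x can be translated along e until ||x||_T = ||x||_H / 2; this gives
    ||T^*||_H^* <= ||T||_H. For the converse one needs, for each y, some mu in
    the dual unit ball with mu y = ||y||_H ([oscillation_functional]). It is
    f - g, where f and g are linear functionals dominated by [top] with
    f y = top y and g (- y) = top (- y); these come from the Hahn-Banach
    theorem, proved here by observing that minimal sublinear functionals are
    linear. *)

Set Implicit Arguments.
Unset Strict Implicit.
Unset Printing Implicit Defensive.

(** * Sublinear functionals and the Hahn-Banach theorem *)

Section Sublinear.
Context {R : realType} {V : lmodType R}.
Implicit Types (p q : V -> R) (F : set (V -> R)) (x y : V).

Definition sublinear p : Prop :=
  (forall x y, p (x + y) <= p x + p y) /\
  (forall a x, 0 < a -> p (a *: x) <= a * p x).

Lemma sublinear0 p : sublinear p -> p 0 = 0.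
Proof.
move=> [_ pZ]; apply/eqP; rewrite eq_le.
have := pZ 2 0 (ltr0Sn _ _).
have : 0 < 2^-1 :> R by rewrite invr_gt0.
move=> /(pZ 2^-1 0).
by rewrite !scaler0 => h1 h2; apply/andP; split; lra.
Qed.

Lemma sublinearZ p a x : sublinear p -> 0 <= a -> p (a *: x) = a * p x.
Proof.
move=> sp; rewrite le_eqVlt => /orP[/eqP<-|a0].
  by rewrite scale0r mul0r sublinear0.
have [_ pZ] := sp.
apply/le_anti/andP; split; first exact: pZ.
have /(pZ a^-1 (a *: x)) : 0 < a^-1 by rewrite invr_gt0.
by rewrite scalerA mulVf ?gt_eqF// scale1r ler_pdivlMl.
Qed.

(** The bound on the unit ball is applied to x / (q x + eps) rather than to
    x / q x, so that vectors with q x = 0 need no separate treatment. *)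
Lemma homogeneous_le p q c : 0 <= c -> (forall x, 0 <= q x) ->
  (forall a x, 0 <= a -> p (a *: x) = a * p x) ->
  (forall a x, 0 <= a -> q (a *: x) = a * q x) ->
  (forall x, q x <= 1 -> p x <= c) -> forall x, p x <= c * q x.
Proof.
move=> c0 q0 pZ qZ pq x; apply/ler_addgt0Pr => eps eps0.
have c1 : 0 < c + 1 by rewrite ltr_wpDl.
pose t := q x + eps / (c + 1).
have t0 : 0 < t by rewrite ltr_wpDl// divr_gt0.
have tV0 : 0 <= t^-1 by rewrite invr_ge0 ltW.
have /pq : q (t^-1 *: x) <= 1.
  by rewrite qZ// ler_pdivrMl// mulr1 lerDl divr_ge0// ltW.
rewrite pZ// ler_pdivrMl// => /le_trans; apply.
rewrite mulrDl (mulrC c) lerD2l mulrAC ler_pdivrMr// ler_pM2l// lerDl//.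
Qed.

Lemma sublinear_opp_ge0 p x : sublinear p -> 0 <= p x + p (- x).
Proof.
by move=> sp; have [pD _] := sp; rewrite -(sublinear0 sp) -(subrr x); exact: pD.
Qed.

(** Since p 0 = 0 <= p x + p (- x) always holds, the hypothesis makes p odd; then
    subadditivity at x + y and - y reverses subadditivity at x and y. *)
Lemma sublinear_linear p : sublinear p ->
  (forall x, p x + p (- x) <= 0) -> linear (p : V -> R^o).
Proof.
move=> sp p0; have [pD _] := sp.
have pN x : p (- x) = - p x.
  have := sublinear_opp_ge0 x sp; have := p0 x; lra.
have {}pD x y : p (x + y) = p x + p y.
  apply/le_anti; rewrite pD/=.
  have := pD (x + y) (- y); rewrite addrK pN; lra.
move=> a x y; rewrite pD; congr (_ + _).
have [a0|a0] := leP 0 a; first by rewrite sublinearZ.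
by rewrite -[a]opprK scaleNr pN sublinearZ ?oppr_ge0 1?ltW// [RHS]scaleNr.
Qed.

(** Subadditivity survives the infimum because, for two members of a chain, the
    smaller one can be used to estimate both terms at once. This serves twice:
    for the chains in Zorn's lemma and for the decreasing sequence whose limit
    is the invariant functional. *)
Lemma chain_inf_sublinear F (m : V -> R) :
  F !=set0 -> F `<=` sublinear ->
  (forall p q, F p -> F q -> (forall x, p x <= q x) \/ (forall x, q x <= p x)) ->
  (forall p x, F p -> m x <= p x) ->
  sublinear (fun x => inf [set p x | p in F]).
Proof.
move=> [p0 Fp0] Fsub Ftot Fm.
have lb p x : F p -> inf [set p x | p in F] <= p x.
  move=> Fp; apply: ge_inf; last by exists p.
  by exists (m x) => _ [q Fq <-]; exact: Fm.
have ne x : [set p x | p in F] !=set0 by exists (p0 x), p0.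
split=> [x y|a x a0] /=.
- rewrite -lerBlDl; apply: lb_le_inf => // _ [q Fq <-].
  rewrite lerBlDl [leRHS]addrC -lerBlDl; apply: lb_le_inf => // _ [p Fp <-].
  rewrite lerBlDl.
  have [pq|qp] := Ftot _ _ Fp Fq.
  + apply: (le_trans (lb _ _ Fp)); apply: (le_trans ((Fsub _ Fp).1 x y)).
    by have := pq y; lra.
  + apply: (le_trans (lb _ _ Fq)); apply: (le_trans ((Fsub _ Fq).1 x y)).
    by have := qp x; lra.
- rewrite -ler_pdivrMl//; apply: lb_le_inf => // _ [p Fp <-].
  rewrite ler_pdivrMl//; apply: (le_trans (lb _ _ Fp)).
  exact: (Fsub _ Fp).2.
Qed.

(** The largest sublinear functional below p that is affine, with slope p y, in
    the direction y. Passing from p to it is how a sublinear functional can be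
    lowered as long as it is not additive. *)
Definition directional p y x : R :=
  inf [set p (x + t *: y) - t * p y | t in [set t | 0 <= t]].

Lemma directional_le p y x t : sublinear p -> 0 <= t ->
  directional p y x <= p (x + t *: y) - t * p y.
Proof.
move=> sp t0; apply: ge_inf; last by exists t.
exists (- p (- x)) => _ [s /= s0 <-].
have := sp.1 (x + s *: y) (- x).
rewrite addrAC subrr add0r sublinearZ//; lra.
Qed.

Lemma directional_sublinear p y : sublinear p -> sublinear (directional p y).
Proof.
move=> sp.
have ne x : [set p (x + t *: y) - t * p y | t in [set t | 0 <= t]] !=set0.
  by exists (p (x + 0 *: y) - 0 * p y), 0 => /=.
split=> [x z|a x a0].
- rewrite -lerBlDl; apply: lb_le_inf => // _ [t /= t0 <-].
  rewrite lerBlDl [leRHS]addrC -lerBlDl; apply: lb_le_inf => // _ [s /= s0 <-].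
  rewrite lerBlDl.
  apply: (le_trans (directional_le y (x + z) sp (addr_ge0 t0 s0))).
  have := sp.1 (x + s *: y) (z + t *: y).
  by rewrite addrACA -scalerDl (addrC s t); lra.
- rewrite -ler_pdivrMl//; apply: lb_le_inf => // _ [t /= t0 <-].
  rewrite ler_pdivrMl//.
  apply: (le_trans (directional_le y (a *: x) sp (mulr_ge0 (ltW a0) t0))).
  have := sp.2 a (x + t *: y) a0.
  by rewrite scalerDr scalerA; lra.
Qed.

Lemma directional_id p y x : sublinear p -> directional p y x <= p x.
Proof.
move=> sp; have := directional_le y x sp (lexx 0).
by rewrite scale0r addr0 mul0r subr0.
Qed.

(** Zorn's lemma for the reversed pointwise order; a chain below q is bounded
    from below at x by - q (- x). *)
Lemma minimal_sublinear q : sublinear q -> exists p,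
  [/\ sublinear p, forall x, p x <= q x &
      forall p', sublinear p' -> (forall x, p' x <= p x) -> p' = p].
Proof.
move=> sq; pose S := {p : V -> R | sublinear p /\ forall x, p x <= q x}.
pose below (p p' : S) := `[< forall x, sval p' x <= sval p x >].
have [|||A Atot|[p [sp pq]] pmin] := @Zorn S below.
- by move=> p; apply/asboolP.
- move=> a b c /asboolP ab /asboolP bc; apply/asboolP => x.
  by apply: le_trans (ab x).
- move=> [a Pa] [b Pb] /asboolP/= ab /asboolP/= ba; apply: eq_exist.
  by apply/funext => x; apply/le_anti; rewrite ba ab.
- have [[a0 Aa0]|A0] := pselect (A !=set0).
    have slow (p : V -> R) x : sublinear p ->
        (forall x, p x <= q x) -> - q (- x) <= p x.
      by move=> sp pq; have := sublinear_opp_ge0 x sp; have := pq (- x); lra.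
    pose F := [set sval a | a in A].
    have lowF (p : V -> R) x : F p -> - q (- x) <= p x.
      by move=> [[p' [sp' pq']] _ <-]; exact: slow.
    have sF : sublinear (fun x => inf [set p x | p in F]).
      apply: (@chain_inf_sublinear F (fun x => - q (- x))) => //.
      + by exists (sval a0), a0.
      + by move=> _ [[p [sp ?]] _ <-].
      + move=> _ _ [a Aa <-] [b Ab <-].
        by have [/asboolP|/asboolP] := Atot _ _ Aa Ab; [right|left].
    have infF a x : A a -> inf [set p x | p in F] <= sval a x.
      move=> Aa; apply: ge_inf; last by exists (sval a) => //; exists a.
      by exists (- q (- x)) => _ [p Fp <-]; exact: lowF.
    have Fq x : inf [set p x | p in F] <= q x.
      by apply: (le_trans (infF a0 x Aa0)); exact: (svalP a0).2.
    exists (exist _ (fun x => inf [set p x | p in F]) (conj sF Fq)) => a Aa.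
    by apply/asboolP => x /=; exact: infF.
  exists (exist _ q (conj sq (fun x => lexx (q x)))) => a Aa.
  by exfalso; apply: A0; exists a.
exists p; split=> // p' sp' p'p.
have p'q x : p' x <= q x by apply: le_trans (pq x).
have /(congr1 sval)//= : exist _ p' (conj sp' p'q) = exist _ p (conj sp pq) :> S.
by apply: pmin; apply/asboolP.
Qed.

(** A minimal sublinear functional p is linear: it coincides with its
    directional lowering along each x, and evaluating the latter at - x gives
    p (- x) <= - p x. Minimising below the lowering of q along y, instead of
    below q, moreover forces p (- y) <= - q y, that is, the value q y at y. *)
Lemma hahn_banach_sublinear q y : sublinear q ->
  exists f : {linear V -> R^o}, (forall x, f x <= q x) /\ f y = q y.
Proof.
move=> sq.
have [p [sp pq' pmin]] := minimal_sublinear (directional_sublinear y sq).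
have pq x : p x <= q x by exact: le_trans (pq' x) (directional_id y x sq).
have lp : linear (p : V -> R^o).
  apply: sublinear_linear => // x.
  have <- : directional p x = p.
    by apply: pmin => [|z]; [exact: directional_sublinear|exact: directional_id].
  have := directional_le x (- x) sp ler01.
  have := directional_id x x sp.
  by rewrite scale1r addNr sublinear0//; lra.
pose f : {linear V -> R^o} :=
  HB.pack (p : V -> R^o) (GRing.isLinear.Build _ _ _ _ (p : V -> R^o) lp).
exists f; split => //; apply/le_anti; rewrite [f y <= _]pq /=.
have := le_trans (pq' (- y)) (directional_le y (- y) sq ler01).
rewrite scale1r addNr sublinear0// mul1r sub0r.
have -> : p (- y) = - p y by exact: (linearN f).
by rewrite lerN2.
Qed.

End Sublinear.

(** * The gauge of an order unit *)

Section OrderUnit.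
Context {R : realType} {X : normedModType R} (C : set X) (e : X).
Hypotheses (C_closed : closed C) (C_cone : pointed_convex_cone C)
  (C_normal : normal_cone C) (e_int : interior C e) (e_neq0 : e != 0).
Implicit Types (x y : X) (t : R).

Definition top x : R := inf [set t | cone_le C x (t *: e)].

Lemma cone0 : C 0.
Proof.
case: C_cone => CZ _ _; rewrite -(scale0r e).
by apply: CZ => //; exact: interior_subset.
Qed.

(** A ball around e of radius d lies in C; rescaling it until it reaches x costs
    the constant 2 / d, the factor 2 keeping the point inside the open ball. *)
Lemma cone_absorbing : exists2 M : R, 0 <= M &
  forall x, cone_le C x ((M * `|x|) *: e).
Proof.
have [CZ CD _] := C_cone.
have /nbhs_ballP[d /= d0 dC] : nbhs e C by exact: e_int.
exists (2 / d) => [|x]; first by rewrite divr_ge0// ltW.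
have [->|x0] := eqVneq x 0.
  by rewrite /cone_le normr0 mulr0 scale0r subrr; exact: cone0.
have nx : 0 < `|x| by rewrite normr_gt0.
have a0 : 0 < 2 / d * `|x| by rewrite mulr_gt0// divr_gt0.
rewrite /cone_le; have -> : (2 / d * `|x|) *: e - x =
    (2 / d * `|x|) *: (e - (2 / d * `|x|)^-1 *: x).
  by rewrite scalerBr scalerA divff ?gt_eqF// scale1r.
apply: CZ; first exact: ltW.
apply: dC; rewrite -ball_normE /= opprB addrC subrK normrZ gtr0_norm ?invr_gt0//.
rewrite invfM mulfVK ?gt_eqF// invf_div.
by rewrite ltr_pdivrMr// ltr_pMr// ltr1n.
Qed.

(** This is where pointedness enters: t < 0 would put - e in C next to e. It is
    what keeps the sets defining the gauge bounded from below. *)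
Lemma cone_unit_ge0 t : C (t *: e) -> 0 <= t.
Proof.
move=> Ct; rewrite leNgt; apply/negP => t0.
have [CZ _ C0] := C_cone.
suff /eqP : e = 0 by exact/negP.
suff : (C `&` (-%R @` C)) e by rewrite C0.
split; first exact: interior_subset.
exists (- e); last by rewrite opprK.
have -> : - e = (- t)^-1 *: (t *: e).
  by rewrite scalerA invrN mulNr mulVf ?lt_eqF// scaleN1r.
by apply: CZ => //; rewrite invr_ge0 oppr_ge0 ltW.
Qed.

Lemma top_has_inf x : has_inf [set t | cone_le C x (t *: e)].
Proof.
have [_ CD _] := C_cone.
have [M M0 absorb] := cone_absorbing.
split; first by exists (M * `|x|); exact: absorb.
exists (- (M * `|- x|)) => t /= xt.
have := CD _ _ xt (absorb (- x)).
rewrite opprK addrACA addNr addr0 -scalerDl => /cone_unit_ge0.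
by rewrite -lerBlDr sub0r.
Qed.

(** The infimum is attained because C is closed: x <= s e for every s > top x,
    and s e - x converges to top x e - x as s decreases to top x. *)
Lemma topP x t : cone_le C x (t *: e) <-> top x <= t.
Proof.
have [CZ CD _] := C_cone.
split=> [xt|].
  by apply: ge_inf => //; exact: (top_has_inf x).2.
have up s s' : s <= s' -> cone_le C x (s *: e) -> cone_le C x (s' *: e).
  move=> ss' xs; rewrite /cone_le -(subrK s s') scalerDl -addrA.
  apply: CD => //; apply: CZ; first by rewrite subr_ge0.
  exact: interior_subset.
move=> /up; apply.
apply: (@closed_cvg _ _ (top x)^'+ _ (fun s => s *: e - x) C) => //.
  near=> s.
  have [|s' xs' s's] := @inf_lt R [set t | cone_le C x (t *: e)] s (top_has_inf x).1.
    by near: s; exact: nbhs_right_gt.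
  exact: up (ltW s's) xs'.
apply: cvgB; last exact: cvg_cst.
apply: cvgZr_tmp.
exact: cvg_at_right_filter.
Unshelve. all: by end_near. Qed.

Lemma top_sublinear : sublinear top.
Proof.
have [CZ CD _] := C_cone.
have le_top x : cone_le C x (top x *: e) by apply/topP.
split=> [x y|a x a0]; apply/topP; rewrite /cone_le.
  by rewrite scalerDl opprD addrACA; apply: CD; exact: le_top.
by rewrite -scalerA -scalerBr; apply: CZ; [exact: ltW|exact: le_top].
Qed.

Lemma top_unitD x t : top (x + t *: e) = top x + t.
Proof.
have h y s : top (y + s *: e) <= top y + s.
  by apply/topP; rewrite /cone_le scalerDl opprD addrACA subrr addr0; exact/topP.
apply/le_anti; rewrite h/= -lerBrDr -{1}[x](addrK (t *: e)) -scaleNr.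
exact: h.
Qed.

Lemma top_unit : top e = 1.
Proof.
by have := top_unitD 0 1; rewrite add0r scale1r (sublinear0 top_sublinear) add0r.
Qed.

Lemma top_oppr_le0 x : C x -> top (- x) <= 0.
Proof. by move=> Cx; apply/topP; rewrite /cone_le scale0r sub0r opprK. Qed.

Lemma top_bounded : exists2 M : R, 0 <= M & forall x, top x <= M * `|x|.
Proof.
by have [M M0 absorb] := cone_absorbing; exists M => // x; apply/topP; exact: absorb.
Qed.

Lemma hopfE x : hopf_seminorm C e x = top x + top (- x).
Proof.
rewrite /hopf_seminorm; congr (_ + _).
rewrite /top /inf; congr (- sup _).
apply/seteqP; split=> t /=.
  move=> xt; exists (- t); last by rewrite opprK.
  by rewrite /cone_le opprK addrC scaleNr.
by move=> [s xs <-]; move: xs; rewrite /cone_le opprK addrC scaleNr opprK.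
Qed.

Lemma thompsonE x : thompson_norm C e x = Num.max (top x) (top (- x)).
Proof.
have m0 : 0 <= Num.max (top x) (top (- x)).
  by have := sublinear_opp_ge0 x top_sublinear; rewrite le_max; case: leP => //=; lra.
have setE a : [/\ 0 < a, cone_le C (- (a *: e)) x & cone_le C x (a *: e)] <->
    0 < a /\ Num.max (top x) (top (- x)) <= a.
  have lo : cone_le C (- (a *: e)) x <-> top (- x) <= a.
    by rewrite -topP /cone_le !opprK addrC.
  rewrite ge_max; split=> [[a0 /lo -> /topP ->]//|[a0 /andP[/topP xa /lo xa']]].
  by split.
(* The infimum is over positive a only and is not attained at x = 0, whence eps. *)
rewrite /thompson_norm; apply/le_anti/andP; split.
  apply/ler_addgt0Pr => eps eps0; apply: ge_inf.
    by exists 0 => a [/ltW].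
  apply/setE; split; first by rewrite ltr_wpDl.
  by rewrite lerDl ltW.
apply: lb_le_inf => [|a /setE[]//].
exists (Num.max (top x) (top (- x)) + 1); apply/setE; split; first by rewrite ltr_wpDl.
by rewrite lerDl.
Qed.

Lemma hopf0 : hopf_seminorm C e 0 = 0.
Proof. by rewrite hopfE oppr0 (sublinear0 top_sublinear) addr0. Qed.

Lemma thompson0 : thompson_norm C e 0 = 0.
Proof. by rewrite thompsonE oppr0 (sublinear0 top_sublinear) maxxx. Qed.

Lemma hopf_ge0 x : 0 <= hopf_seminorm C e x.
Proof. by rewrite hopfE; exact: sublinear_opp_ge0 top_sublinear. Qed.

Lemma hopf_le_thompson x : hopf_seminorm C e x <= 2 * thompson_norm C e x.
Proof. by rewrite hopfE thompsonE; case: (leP (top x)); lra. Qed.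

Lemma thompson_ge0 x : 0 <= thompson_norm C e x.
Proof. by have := hopf_ge0 x; have := hopf_le_thompson x; lra. Qed.

Lemma hopfZ a x : 0 <= a -> hopf_seminorm C e (a *: x) = a * hopf_seminorm C e x.
Proof.
by move=> a0; rewrite !hopfE -scalerN !(sublinearZ _ top_sublinear)// mulrDr.
Qed.

Lemma thompsonZ a x : 0 <= a ->
  thompson_norm C e (a *: x) = a * thompson_norm C e x.
Proof.
by move=> a0; rewrite !thompsonE -scalerN !(sublinearZ _ top_sublinear)// maxr_pMr.
Qed.

(** The midpoint of the order interval spanned by x is the translation that
    minimises the Thompson norm, whence the factor 1/2 relating the two dual
    norms. *)
Lemma thompson_centered x :
  exists c : R, thompson_norm C e (x - c *: e) = 2^-1 * hopf_seminorm C e x.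
Proof.
exists ((top x - top (- x)) / 2).
rewrite thompsonE hopfE opprB (addrC (_ *: e)) -scaleNr !top_unitD.
by case: (leP (_ + - _)); lra.
Qed.

(** With a = ||x||_T one has 0 <= x + a e <= 2 a e, to which normality applies. *)
Lemma norm_le_thompson : exists2 K : R, 0 <= K &
  forall x, `|x| <= K * thompson_norm C e x.
Proof.
have [CZ CD _] := C_cone.
have [K K0 normal] := C_normal.
exists ((2 * K + 1) * `|e|) => [|x].
  by rewrite mulr_ge0// addr_ge0// mulr_ge0// ltW.
set a := thompson_norm C e x.
have a0 : 0 <= a := thompson_ge0 x.
have xa : cone_le C x (a *: e) by apply/topP; rewrite /a thompsonE le_max lexx.
have ax : cone_le C (- x) (a *: e).
  by apply/topP; rewrite /a thompsonE le_max lexx orbT.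
have : `|x + a *: e| <= K * `|(2 * a) *: e|.
  apply: normal; rewrite /cone_le.
    by rewrite subr0 -[x]opprK addrC.
  by rewrite mulr_natl mulr2n scalerDl opprD addrACA subrr addr0.
rewrite !normrZ !ger0_norm ?mulr_ge0// => h.
have := ler_normB (x + a *: e) (a *: e).
rewrite addrK normrZ ger0_norm// => h'.
by apply: (le_trans h'); apply: (le_trans (lerD h (lexx _))); lra.
Qed.

(** * Dual norms *)

(** The suprema defining dual norms range over the Thompson unit ball; this bound
    makes them genuine suprema for continuous functionals. *)
Lemma continuous_thompson_bounded (mu : {linear X -> R^o}) : continuous mu ->
  exists B : R, forall x, `|mu x| <= B * thompson_norm C e x.
Proof.
move=> /linear_bounded_continuous/linear_boundedP mu_bnd.
have [K K0 normK] := norm_le_thompson.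
have [B B0 muB] := pinfty_ex_gt0 mu_bnd.
exists (B * K) => x; apply: (le_trans (muB x)).
by rewrite -mulrA ler_pM2l.
Qed.

Lemma dual_thompson_le (mu : X -> R^o) (c : R) :
  (forall x, thompson_norm C e x <= 1 -> `|mu x| <= c) ->
  dual_thompson_norm C e mu <= c.
Proof.
move=> muc; apply: ge_sup => [|_ [x /= x1 <-]]; last exact: muc.
by exists `|mu 0|, 0 => //=; rewrite thompson0.
Qed.

Lemma dual_thompson_ub (mu : X -> R^o) (B : R) x :
  (forall x, `|mu x| <= B * thompson_norm C e x) ->
  thompson_norm C e x <= 1 -> `|mu x| <= dual_thompson_norm C e mu.
Proof.
move=> muB x1; apply: ub_le_sup; last by exists x.
exists `|B| => _ [y /= y1 <-]; apply: (le_trans (muB y)).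
apply: (@le_trans _ _ (`|B| * thompson_norm C e y)).
  by rewrite ler_wpM2r ?thompson_ge0// ler_norm.
by rewrite ler_piMr.
Qed.

Lemma dual_thompson_ge0 (mu : X -> R^o) (B : R) :
  (forall x, `|mu x| <= B * thompson_norm C e x) ->
  0 <= dual_thompson_norm C e mu.
Proof.
move=> muB; apply: (le_trans (normr_ge0 (mu 0))).
by apply: (dual_thompson_ub muB); rewrite thompson0.
Qed.

Lemma le_dual_thompson (mu : {linear X -> R^o}) (B : R) :
  (forall x, `|mu x| <= B * thompson_norm C e x) ->
  forall x, `|mu x| <= dual_thompson_norm C e mu * thompson_norm C e x.
Proof.
move=> muB; apply: homogeneous_le => //.
- exact: dual_thompson_ge0 muB.
- exact: thompson_ge0.
- by move=> a x a0; rewrite linearZ/= normrM ger0_norm.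
- by move=> a x a0; exact: thompsonZ.
- by move=> x; exact: dual_thompson_ub muB.
Qed.

Lemma null_functional_le_hopf (mu : {linear X -> R^o}) (B : R) :
  (forall x, `|mu x| <= B * thompson_norm C e x) -> mu e = 0 ->
  forall x, `|mu x| <= dual_hopf_norm C e mu * hopf_seminorm C e x.
Proof.
move=> muB mue x; have [c xc] := thompson_centered x.
have := le_dual_thompson muB (x - c *: e).
rewrite linearB linearZ/= mue scaler0 subr0 xc /dual_hopf_norm.
by rewrite mulrCA mulrA.
Qed.

(** In one direction, mu is applied to top x e - x, an element of C. Conversely,
    domination by the gauge at e and - e gives mu e = 1, on - C it gives
    positivity, and continuity comes from top x <= M |x|. *)
Lemma unit_functionalP (mu : {linear X -> R^o}) :
  unit_functionals C e mu <-> forall x, mu x <= top x.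
Proof.
split=> [[[_ mu_ge0] mue] x|mu_top].
  have /mu_ge0 : cone_le C x (top x *: e) by apply/topP.
  by rewrite linearB linearZ/= mue subr_ge0 [_ *: _]mulr1.
have muN x : - mu x <= top (- x) by rewrite -linearN.
split; last first.
  apply/le_anti; rewrite -{1}top_unit mu_top /=.
  have := muN e; have := top_unitD (- e) 1; rewrite scale1r addNr.
  rewrite (sublinear0 top_sublinear); lra.
split; last by move=> x Cx; have := muN x; have := top_oppr_le0 Cx; lra.
split; first exact: linearP.
apply: bounded_linear_continuous; apply/linear_boundedP.
have [M M0 topM] := top_bounded.
near=> r => x; rewrite ler_norml.
have rM : M * `|x| <= r * `|x|.
  by rewrite ler_wpM2r//; near: r; apply: nbhs_pinfty_ge; rewrite num_real.
apply/andP; split; last by apply: le_trans rM; apply: (le_trans (mu_top x)).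
rewrite lerNl; apply: le_trans rM; apply: (le_trans (muN x)).
by rewrite -[`|x|]normrN.
Unshelve. all: by end_near. Qed.

(** * Consensus operators *)

Section Consensus.
Variable T : {linear X -> X}.
Hypotheses (T_cone : T @` C `<=` C) (T_unit : T e = e).

Lemma top_consensus x : top (T x) <= top x.
Proof.
apply/topP; rewrite /cone_le.
have -> : top x *: e - T x = T (top x *: e - x) by rewrite linearB linearZ/= T_unit.
by apply: T_cone; exists (top x *: e - x) => //; apply/topP.
Qed.

Lemma hopf_consensus x : hopf_seminorm C e (T x) <= hopf_seminorm C e x.
Proof. by rewrite !hopfE lerD// -?linearN top_consensus. Qed.

Lemma thompson_consensus x : thompson_norm C e (T x) <= thompson_norm C e x.
Proof.
by rewrite !thompsonE ge_max !le_max top_consensus -linearN top_consensus orbT.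
Qed.

Let h := hopf_opnorm C e T.

Lemma hopf_opnorm_ub x : hopf_seminorm C e x <= 1 -> hopf_seminorm C e (T x) <= h.
Proof.
move=> x1; apply: ub_le_sup; last by exists x.
by exists 1 => _ [y /= y1 <-]; apply: le_trans y1; exact: hopf_consensus.
Qed.

Lemma hopf_opnorm_ge0 : 0 <= h.
Proof.
by apply: le_trans (hopf_opnorm_ub (x := 0) _); rewrite ?hopf_ge0// hopf0.
Qed.

Lemma hopf_contract x : hopf_seminorm C e (T x) <= h * hopf_seminorm C e x.
Proof.
move: x; apply: homogeneous_le hopf_opnorm_ge0 hopf_ge0 _ _ hopf_opnorm_ub.
- by move=> a x a0; rewrite linearZ/= hopfZ.
- by move=> a x a0; exact: hopfZ.
Qed.

Lemma hopf_contract_iter n x :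
  hopf_seminorm C e (iter n T x) <= h ^+ n * hopf_seminorm C e x.
Proof.
elim: n => [|n IH]; first by rewrite expr0 mul1r.
rewrite iterS; apply: (le_trans (hopf_contract _)).
by rewrite exprS -mulrA ler_wpM2l ?hopf_opnorm_ge0.
Qed.

(** Positivity of T alone transfers Thompson boundedness from mu to mu o T, so
    that the dual norm of mu o T is a genuine supremum. *)
Lemma adjoint_thompson_bounded (mu : X -> R^o) (B : R) : 0 <= B ->
  (forall x, `|mu x| <= B * thompson_norm C e x) ->
  forall x, `|adjoint T mu x| <= B * thompson_norm C e x.
Proof.
move=> B0 muB x; apply: (le_trans (muB (T x))).
by rewrite ler_wpM2l// thompson_consensus.
Qed.

(** |mu (T x)| <= ||T x||_H <= h ||x||_H <= 2 h on the Thompson unit ball. *)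
Lemma dual_hopf_adjoint_le (mu : X -> R^o) :
  null_functionals e mu -> dual_hopf_norm C e mu <= 1 ->
  dual_hopf_norm C e (adjoint T mu) <= h.
Proof.
move=> [[lmu cmu] mue] mu1.
pose f : {linear X -> R^o} := HB.pack mu (GRing.isLinear.Build _ _ _ _ mu lmu).
have [B fB] := @continuous_thompson_bounded f cmu.
rewrite /dual_hopf_norm ler_pdivrMl//; apply: dual_thompson_le => x x1.
have := null_functional_le_hopf (mu := f) fB mue (T x).
move=> /le_trans; apply.
apply: (@le_trans _ _ (hopf_seminorm C e (T x))).
  by rewrite ler_piMl// hopf_ge0.
apply: (le_trans (hopf_contract x)).
rewrite mulrC ler_wpM2r ?hopf_opnorm_ge0//.
by apply: (le_trans (hopf_le_thompson x)); rewrite ler_piMr.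
Qed.

(** The difference of a functional of P(e) that is maximal at y and one that is
    minimal at y. Two elements of P(e) differ by at most 2 on the Thompson unit
    ball, so that the difference has dual Hopf norm at most 1. *)
Lemma oscillation_functional y : exists mu : {linear X -> R^o},
  [/\ forall x, `|mu x| <= 2 * thompson_norm C e x, null_functionals e mu,
      dual_hopf_norm C e mu <= 1 & mu y = hopf_seminorm C e y].
Proof.
have [f [ftop fy]] := hahn_banach_sublinear y top_sublinear.
have [g [gtop gy]] := hahn_banach_sublinear (- y) top_sublinear.
have [[[_ fcont] _] fe] := (unit_functionalP f).2 ftop.
have [[[_ gcont] _] ge] := (unit_functionalP g).2 gtop.
pose mu : {linear X -> R^o} := f \- g.
have muB x : `|mu x| <= 2 * thompson_norm C e x.
  have top_le z : top z <= thompson_norm C e z by rewrite thompsonE le_max lexx.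
  have topN_le z : top (- z) <= thompson_norm C e z.
    by rewrite thompsonE le_max lexx orbT.
  rewrite ler_norml /=.
  have := ftop x; have := ftop (- x); have := gtop x; have := gtop (- x).
  have := top_le x; have := topN_le x; rewrite !linearN; lra.
exists mu; split=> //.
- split; last by rewrite /= fe ge subrr.
  split; first exact: linearP.
  by move=> x; apply: cvgB; [exact: fcont|exact: gcont].
- rewrite /dual_hopf_norm ler_pdivrMl// mulr1; apply: dual_thompson_le => x x1.
  by apply: (le_trans (muB x)); rewrite ler_piMr.
- by rewrite hopfE -fy -gy /= linearN.
Qed.

(** For the lower bound, a functional mu that measures the oscillation of T x
    yields ||T x||_H = (mu o T) x <= ||mu o T||_H^* ||x||_H. *)
Lemma hopf_opnorm_adjoint : dual_hopf_opnorm C e (adjoint T) = h.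
Proof.
have null0 : null_functionals e (cst 0 : X -> R^o).
  split=> //; split; last exact: cst_continuous.
  by move=> a x y /=; rewrite scaler0 addr0.
have dual0 : dual_hopf_norm C e (cst 0 : X -> R^o) <= 1.
  rewrite /dual_hopf_norm ler_pdivrMl// mulr1; apply: dual_thompson_le => x _.
  by rewrite normr0.
apply/le_anti/andP; split.
  apply: ge_sup => [|_ [mu [mu0 mu1] <-]]; last exact: dual_hopf_adjoint_le.
  by exists (dual_hopf_norm C e (adjoint T (cst 0))), (cst 0).
apply: ge_sup => [|_ [x /= x1 <-]].
  by exists (hopf_seminorm C e (T 0)), 0 => //=; rewrite hopf0.
have [mu [muB mu0 mu1 muTx]] := oscillation_functional (T x).
pose nu : {linear X -> R^o} := mu \o T.
have nue : nu e = 0 by rewrite /= T_unit; case: mu0.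
have nuB := adjoint_thompson_bounded (ler0n _ _) muB.
rewrite -muTx; apply: (le_trans (ler_norm _)).
apply: (le_trans (null_functional_le_hopf (mu := nu) nuB nue x)).
apply: (@le_trans _ _ (dual_hopf_norm C e (adjoint T mu))).
  apply: ler_piMr => //; rewrite /dual_hopf_norm mulr_ge0//.
  exact: dual_thompson_ge0 nuB.
apply: ub_le_sup; last by exists mu.
by exists h => _ [m [m0 m1] <-]; exact: dual_hopf_adjoint_le.
Qed.

Lemma top_iter_le n k x : top (iter (n + k) T x) <= top (iter k T x).
Proof.
by elim: n => [//|n IH]; rewrite addSn iterS; apply: le_trans IH; exact: top_consensus.
Qed.

Lemma iterN n x : iter n T (- x) = - iter n T x.
Proof. by elim: n => [//|n IH] /=; rewrite IH linearN. Qed.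

(** The functional is the infimum over n of the gauges x |-> top (T^n x), a
    decreasing sequence of sublinear functionals. Its values at x and - x add up
    to at most ||T^n x||_H for every n, which tends to 0. The bounds stated
    here, used at x and at - x, already contain the rate of convergence. *)
Lemma consensus_limit : h < 1 -> exists pi : {linear X -> R^o},
  forall n x, pi x <= top (iter n T x).
Proof.
move=> h1.
pose F := [set (fun x => top (iter n T x)) | n in [set: nat]].
have iterD n x y : iter n T (x + y) = iter n T x + iter n T y.
  by elim: n => [//|n IH] /=; rewrite IH linearD.
have iterZ n a x : iter n T (a *: x) = a *: iter n T x.
  by elim: n => [//|n IH] /=; rewrite IH linearZ.
have low n x : - top (- x) <= top (iter n T x).
  have := top_iter_le n 0 (- x); rewrite addn0 iterN /=.
  by have := sublinear_opp_ge0 (iter n T x) top_sublinear; lra.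
pose p x := inf [set q x | q in F].
have sp : sublinear p.
  apply: (@chain_inf_sublinear _ _ F (fun x => - top (- x))).
  - by exists (fun x => top (iter 0 T x)), 0%N.
  - have [topD topZ] := top_sublinear.
    by move=> _ [n _ <-]; split=> [x y|a x a0]; rewrite ?iterD ?iterZ; auto.
  - move=> _ _ [n _ <-] [m _ <-].
    by have [nm|/ltnW nm] := leqP n m; [right|left] => x;
      rewrite -(subnK nm); exact: top_iter_le.
  - by move=> _ x [n _ <-].
have pn n x : p x <= top (iter n T x).
  apply: ge_inf; last by exists (fun x => top (iter n T x)) => //; exists n.
  by exists (- top (- x)) => _ [_ [m _ <-] <-].
have lp : linear (p : X -> R^o).
  apply: sublinear_linear => // x.
  have pos n : p x + p (- x) <= h ^+ n * hopf_seminorm C e x.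
    apply: le_trans (hopf_contract_iter n x).
    by rewrite hopfE -iterN lerD.
  have hn : (fun n => h ^+ n * hopf_seminorm C e x) @ \oo -->
      0 * hopf_seminorm C e x.
    apply: cvgMr_tmp; apply: cvg_expr.
    by rewrite ger0_norm// hopf_opnorm_ge0.
  rewrite -(mul0r (hopf_seminorm C e x)) -(cvg_lim _ hn)//.
  apply: limr_ge; first by apply/cvg_ex; eexists; exact: hn.
  by near=> n; exact: pos.
pose f : {linear X -> R^o} :=
  HB.pack (p : X -> R^o) (GRing.isLinear.Build _ _ _ _ (p : X -> R^o) lp).
by exists f.
Unshelve. all: by end_near. Qed.

Section Limit.
Variable pi : {linear X -> R^o}.
Hypothesis pi_top : forall n x, pi x <= top (iter n T x).

(** Domination at x and at - x traps pi x between - top (- T^n x) and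
    top (T^n x), two numbers at distance ||T^n x||_H. *)
Lemma thompson_iter_sub_le n x :
  thompson_norm C e (iter n T x - pi x *: e)
    <= h ^+ n * hopf_seminorm C e x.
Proof.
apply: le_trans (hopf_contract_iter n x).
rewrite thompsonE hopfE opprB (addrC (_ *: e)) -scaleNr !top_unitD ge_max.
have := pi_top n x; have := pi_top n (- x); rewrite linearN iterN.
by move=> ? ?; apply/andP; split; lra.
Qed.

Lemma dual_hopf_iter_sub_le n (mu : X -> R^o) : unit_functionals C e mu ->
  dual_hopf_norm C e (iter n (adjoint T) mu - (pi : X -> R^o)) <= h ^+ n.
Proof.
move=> Pmu; have [[[lmu _] _] mue] := Pmu.
pose f : {linear X -> R^o} := HB.pack mu (GRing.isLinear.Build _ _ _ _ mu lmu).
have ftop := (unit_functionalP f).1 Pmu.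
have iter_adjoint x : iter n (adjoint T) mu x = mu (iter n T x).
  by elim: n x => [//|n IH] x; rewrite [in RHS]iterSr -IH.
rewrite /dual_hopf_norm ler_pdivrMl//; apply: dual_thompson_le => x x1.
have -> : (iter n (adjoint T) mu - (pi : X -> R^o)) x = f (iter n T x - pi x *: e).
  by rewrite linearB linearZ/= mue [_ *: _]mulr1 -iter_adjoint.
apply: (@le_trans _ _ (h ^+ n * hopf_seminorm C e x)).
  apply: le_trans (thompson_iter_sub_le n x).
  set y := iter n T x - pi x *: e.
  rewrite thompsonE ler_norml lerNl; apply/andP; split.
    by rewrite -linearN le_max ftop orbT.
  by rewrite le_max ftop.
rewrite mulrC ler_wpM2r ?exprn_ge0 ?hopf_opnorm_ge0//.
by apply: (le_trans (hopf_le_thompson x)); rewrite ler_piMr.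
Qed.

End Limit.

End Consensus.

End OrderUnit.

(** If 0 were interior to C, then C would be the whole space, which is pointed
    only when it is trivial. *)
Lemma unit_neq0 (R : realType) (X : normedModType R) (C : set X) (e : X) :
  (exists x : X, x != 0) -> pointed_convex_cone C -> interior C e -> e != 0.
Proof.
move=> [x x0] C_cone e_int; apply: contraNneq x0 => e0.
have [M M0 absorb] := cone_absorbing C_cone e_int.
have CN y : C (- y) by have := absorb y; rewrite /cone_le e0 scaler0 sub0r.
have [_ _ C0] := C_cone.
suff : (C `&` (-%R @` C)) x by rewrite C0 => ->.
by split; [rewrite -[x]opprK|exists (- x) => //; rewrite opprK].
Qed.

Theorem theorem4p7 (R : realType) (X : completeNormedModType R)
    (X_nontrivial : exists x : X, x != 0)
    (C : set X) (C_closed : closed C) (C_cone : pointed_convex_cone C)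
    (C_normal : normal_cone C) (e : X) (e_int : interior C e)
    (T : X -> X) (T_consensus : consensus_operator C e T) :
  (hopf_opnorm C e T < 1 <-> dual_hopf_opnorm C e (adjoint T) < 1) /\
  (hopf_opnorm C e T < 1 ->
   exists pi : X -> R^o,
     [/\ unit_functionals C e pi,
         forall (n : nat) (x : X),
           thompson_norm C e (iter n T x - pi x *: e)
             <= hopf_opnorm C e T ^+ n * hopf_seminorm C e x &
         forall (n : nat) (mu : X -> R^o), unit_functionals C e mu ->
           dual_hopf_norm C e (iter n (adjoint T) mu - pi)
             <= hopf_opnorm C e T ^+ n]).
Proof.
have e_neq0 := unit_neq0 X_nontrivial C_cone e_int.
have [linT T_cone T_unit] := T_consensus.
pose S : {linear X -> X} := HB.pack T (GRing.isLinear.Build _ _ _ _ T linT).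
rewrite (hopf_opnorm_adjoint C_closed C_cone C_normal e_int e_neq0
  (T := S) T_cone T_unit).
split=> // /(consensus_limit C_closed C_cone e_int e_neq0
  (T := S) T_cone T_unit)[pi pi_top].
exists pi; split.
- by apply/(unit_functionalP C_closed C_cone e_int e_neq0) => x; exact: (pi_top 0%N).
- exact: (thompson_iter_sub_le C_closed C_cone e_int e_neq0 (T := S)).
- exact: (dual_hopf_iter_sub_le C_closed C_cone e_int e_neq0 (T := S)).
Qed.
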